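(* Let $N\ge 1$, $L,D>0$, and let $W\in\mathbb{R}^{N\times N}$ be a lower triangular weight matrix defining a nondegenerate fixed-step gradient method. Then there exists a nonnegative vector $a=(a_0,\dots,a_N)\in\mathbb{R}^{N+1}$ with $\sum_{i=0}^N a_i=1$ such that the following holds for every $d\geq 1$, every $L$-smooth convex function $f:\mathbb{R}^d\to\mathbb{R}$, every minimizer $x_\star$ of $f$, and every $x_0\in\mathbb{R}^d$ with $\|x_0-x_\star\|\le D$, where $x_n=x_0-\sum_{i=0}^{n-1}W_{n-1,i}\,g_i$ for $n=1,\dots,N$ and $g_i=\nabla f(x_i)$ for $i=0,\dots,N$. Write $f_N=f(x_N)$, $f_\star=f(x_\star)$, $$\alpha(x)=\sum_{i=0}^N a_i\Big(f(x_i)+\langle g_i,x-x_i\rangle+\tfrac{1}{2L}\|g_i\|^2\Big),\qquad z_{N+1}=x_0-\frac{D^2}{2\,\mathtt{PEP}_L(W)}\nabla\alpha .$$ Then $\alpha\in A_f^\star$, $$f_N-f_\star\ \le\ f_N-\alpha(x_\star)+\frac{\mathtt{PEP}_L(W)}{D^2}\|z_{N+1}-x_\star\|^2\ \le\ \mathtt{PEP}_L(W),$$ and $$f_N-f_\star\ \le\ f_N-\big(\alpha(x_0)-D\|\nabla\alpha\|\big)\ \le\ \mathtt{PEP}_L(W).$$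
   Context: Rows and columns of $W$ are indexed by $0,\dots,N-1$. $\|\cdot\|$, $\langle\cdot,\cdot\rangle$ are Euclidean. A function is $L$-smooth if it is differentiable with $L$-Lipschitz gradient. $A_f^\star$ is the set of affine functions $\alpha$ on $\mathbb{R}^d$ with $\alpha(x_\star)\le f(x_\star)$. $\nabla\alpha$ is the constant gradient of an affine function. The performance estimation problem (PEP). Let $\mathcal{I}=\{\star,0,\dots,N\}$. The PEP is the semidefinite program in the variables $(f_i)_{i\in\mathcal{I}}\in\mathbb{R}^{N+2}$ and a symmetric positive semidefinite $(N+2)\times(N+2)$ matrix $G$, where $G$ represents the Gram matrix $G=P^\top P$ of $P=[x_0-x_\star,\,g_0,\dots,g_N]$. After substituting $g_\star=0$ and $x_n=x_0-\sum_{i=0}^{n-1}W_{n-1,i}g_i$ ($n=1,\dots,N$), every difference $x_i-x_j$ ($i,j\in\mathcal{I}$) and every $g_i$ is a fixed linear combination of the columns of $P$, so the following are affine functions of $((f_i)_{i\in\mathcal{I}},G)$: $$\mathcal{Q}_{i,j}=f_i-f_j-\langle g_j,x_i-x_j\rangle-\tfrac{1}{2L}\|g_i-g_j\|^2,\qquad \mathcal{D}=D^2-\|x_0-x_\star\|^2 .$$ $\mathtt{PEP}_L(W)$ is the optimal value of: maximize $f_N-f_\star$ subject to $\mathcal{Q}_{i,j}\ge0$ for all $i,j\in\mathcal{I}$, $\mathcal{D}\ge 0$, $G\succeq 0$. (When $d\ge N+2$ this equals the worst case of $f(x_N)-f(x_\star)$ over all $L$-smooth convex $f$ on $\mathbb{R}^d$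 with a minimizer satisfying $\|x_0-x_\star\|\le D$.) The dual semidefinite program is: minimize $r$ over $r\in\mathbb{R}$, $\lambda_{i,j},\sigma\ge0$ ($i,j\in\mathcal{I}$) and $Z\succeq0$ such that $$r-(f_N-f_\star)=\sum_{i,j\in\mathcal{I}}\lambda_{i,j}\mathcal{Q}_{i,j}+\sigma\mathcal{D}+\langle Z,G\rangle$$ holds identically as affine functions of the free variables $((f_i)_{i\in\mathcal{I}},G)$. The method defined by $W$ is nondegenerate if (i) strong duality holds between these two semidefinite programs, with both primal and dual optima attained, and (ii) for each $i=0,\dots,N$ there is an optimal solution of the primal PEP with $f_i-\frac{1}{2L}\|g_i\|^2>f_\star$ (where $\|g_i\|^2$ is the corresponding diagonal entry of $G$). *)

(* Defs.v *)
From HB Require Import structures.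
From mathcomp Require Import all_boot all_order all_algebra.
From mathcomp Require Import all_classical all_reals all_analysis.

Set Implicit Arguments.
Unset Strict Implicit.
Unset Printing Implicit Defensive.

Import Order.TTheory GRing.Theory Num.Theory.
Import numFieldNormedType.Exports.

Local Open Scope classical_set_scope.
Local Open Scope ring_scope.

Section Euclidean.
Context {R : realType} {d : nat}.
Implicit Types (u v x : 'rV[R]_d).

(* The library norm `|u| on 'rV_d is the sup norm, hence these definitions. *)
Definition dotv u v : R := (u *m v^T) 0 0.
Definition enorm u : R := Num.sqrt (dotv u u).

Definition gradient (f : 'rV[R]_d -> R^o) x : 'rV[R]_d :=
  \row_i 'D_(delta_mx 0 i) f x.

Definition smooth (L : R) (f : 'rV[R]_d -> R^o) : Prop :=
  (forall x, differentiable f x) /\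
  (forall x y, enorm (gradient f x - gradient f y) <= L * enorm (x - y)).

Definition convex (f : 'rV[R]_d -> R^o) : Prop :=
  convex_function [set: convex_lmodType 'rV[R]_d] f.

Definition minimizer (f : 'rV[R]_d -> R^o) x : Prop := forall y, f x <= f y.

Definition affine (alpha : 'rV[R]_d -> R^o) : Prop :=
  exists (c : R) v, forall x, alpha x = c + dotv v x.

(* The gradient of an affine function is constant; it is evaluated at 0. *)
Definition affine_gradient (alpha : 'rV[R]_d -> R^o) : 'rV[R]_d :=
  gradient alpha 0.

Definition affine_below_at (f : 'rV[R]_d -> R^o) (xstar : 'rV[R]_d) :
    set ('rV[R]_d -> R^o) :=
  [set alpha | affine alpha /\ alpha xstar <= f xstar].

End Euclidean.

Section FixedStep.
Context {R : realType} {N : nat} {V : lmodType R}.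

(* The point x_n built from x_0 and the gradients g_0, ..., g_N.  If n is not
   ord0 then [unlift ord0 n] is [Some m] with m = n - 1, a row index of W, and
   the sum runs over i = 0, ..., n - 1. *)
Definition fixed_step (W : 'M[R]_N) (x0 : V) (g : 'I_N.+1 -> V)
    (n : 'I_N.+1) : V :=
  if unlift ord0 n is Some m then
    x0 - \sum_(i < N | (i <= m)%N) W m i *: g (widen_ord (leqnSn N) i)
  else x0.

End FixedStep.

Section SDP.
Context {R : realType} {n : nat}.

Definition gram_dot (G : 'M[R]_n) (u v : 'rV[R]_n) : R := (u *m G *m v^T) 0 0.

Definition psd (G : 'M[R]_n) : Prop :=
  G^T = G /\ forall u : 'rV[R]_n, 0 <= gram_dot G u u.

End SDP.

Section PEP.
Context {R : realType} {N : nat}.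
Variables (L D : R) (W : 'M[R]_N).

(* The index set {star, 0, ..., N}; star is None. *)
Local Notation I := (option 'I_N.+1).

(* Coordinates in the columns of P = [x_0 - x_star, g_0, ..., g_N] of g_i and
   of x_i - x_star; column ord0 is x_0 - x_star, column [lift ord0 i] is g_i. *)
Definition gcoord (i : I) : 'rV[R]_N.+2 :=
  if i is Some k then delta_mx 0 (lift ord0 k) else 0.

Definition xcoord (i : I) : 'rV[R]_N.+2 :=
  if i is Some k then
    fixed_step W (delta_mx 0 ord0) (fun j => gcoord (Some j)) k
  else 0.

Definition pepQ (f : I -> R) (G : 'M[R]_N.+2) (i j : I) : R :=
  f i - f j - gram_dot G (gcoord j) (xcoord i - xcoord j)
  - (2 * L)^-1 * gram_dot G (gcoord i - gcoord j) (gcoord i - gcoord j).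

Definition pepD (G : 'M[R]_N.+2) : R := D ^+ 2 - G ord0 ord0.

Definition pep_obj (f : I -> R) : R := f (Some ord_max) - f None.

Definition pep_feasible (f : I -> R) (G : 'M[R]_N.+2) : Prop :=
  [/\ forall i j, 0 <= pepQ f G i j, 0 <= pepD G & psd G].

Definition pep_optimal (f : I -> R) (G : 'M[R]_N.+2) : Prop :=
  pep_feasible f G /\
  forall f' G', pep_feasible f' G' -> pep_obj f' <= pep_obj f.

Definition pep_value : \bar R :=
  ereal_sup [set (pep_obj fG.1)%:E | fG in [set fG | pep_feasible fG.1 fG.2]].

Definition dual_feasible (r : R) (lam : I -> I -> R) (sigma : R)
    (Z : 'M[R]_N.+2) : Prop :=
  [/\ forall i j, 0 <= lam i j, 0 <= sigma, psd Z &
    forall (f : I -> R) (G : 'M[R]_N.+2), G^T = G ->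
      r - pep_obj f =
        \sum_i \sum_j lam i j * pepQ f G i j + sigma * pepD G
        + \tr (Z^T *m G)].

Definition dual_optimal (r : R) (lam : I -> I -> R) (sigma : R)
    (Z : 'M[R]_N.+2) : Prop :=
  dual_feasible r lam sigma Z /\
  forall r' lam' sigma' Z', dual_feasible r' lam' sigma' Z' -> r <= r'.

Definition dual_value : \bar R :=
  ereal_inf [set r%:E | r in
    [set r | exists lam sigma Z, dual_feasible r lam sigma Z]].

Definition nondegenerate_method : Prop :=
  [/\ pep_value = dual_value,
      exists f G, pep_optimal f G,
      exists r lam sigma Z, dual_optimal r lam sigma Z &
      forall i : 'I_N.+1, exists f G, pep_optimal f G /\
        f (Some i) - (2 * L)^-1 * G (lift ord0 i) (lift ord0 i) > f None].

(* Real form of the optimal value; when the optimum is attained, [pep_value]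
   is finite and [fine] loses nothing. *)
Definition PEP : R := fine pep_value.

End PEP.

(* Main.v *)
(* Take a_i to be the multiplier of Q_{star,i} in an optimal dual solution
   (r, lambda, sigma, Z).  Complementary slackness and condition (ii) kill the
   multipliers of Q_{i,star}, so the coefficient of f_star in the dual identity
   gives sum a_i = 1, and its constant term gives r = sigma D^2.  The remaining
   Q_{i,j} involve only x_0, ..., x_N, so the identity may be used with a fictitious
   minimizer x_0 - y for an arbitrary y; this yields
   f_N <= alpha(x_0 - y) + sigma |y|^2.  Choosing y = grad alpha / (2 sigma),
   f_N <= alpha(x_0) - |grad alpha|^2 / (4 sigma), and both chains of inequalities
   follow from alpha(x_star) <= f_star by completing squares. *)

Require Import Defs.
From mathcomp Require Import all_boot all_order all_algebra.
From mathcomp Require Import all_classical all_reals all_analysis.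
From mathcomp Require Import ring lra.
Set Implicit Arguments.
Unset Strict Implicit.
Unset Printing Implicit Defensive.
Import Order.TTheory GRing.Theory Num.Theory.
Import numFieldNormedType.Exports.
Local Open Scope classical_set_scope.
Local Open Scope ring_scope.

(** * Positive semidefinite forms and the Euclidean inner product *)

Section BilinearForms.
Context {R : realType}.

Section GramDot.
Context {n : nat}.
Implicit Types (G Z : 'M[R]_n) (u v w : 'rV[R]_n).

Lemma gram_dotDl G u v w : gram_dot G (u + v) w = gram_dot G u w + gram_dot G v w.
Proof. by rewrite /gram_dot !mulmxDl mxE. Qed.

Lemma gram_dotZl G (c : R) u v : gram_dot G (c *: u) v = c * gram_dot G u v.
Proof. by rewrite /gram_dot -!scalemxAl mxE. Qed.

Lemma gram_dotC G u v : G^T = G -> gram_dot G u v = gram_dot G v u.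
Proof.
move=> sG; rewrite /gram_dot.
have -> : v *m G *m u^T = (u *m G *m v^T)^T by rewrite !trmx_mul trmxK sG mulmxA.
by rewrite [RHS]mxE.
Qed.

Lemma gram_dotDr G u v w : gram_dot G u (v + w) = gram_dot G u v + gram_dot G u w.
Proof. by rewrite /gram_dot linearD mulmxDr mxE. Qed.

Lemma gram_dotZr G (c : R) u v : gram_dot G u (c *: v) = c * gram_dot G u v.
Proof. by rewrite /gram_dot linearZ -scalemxAr mxE. Qed.

Lemma gram_dot_delta G i j : gram_dot G (delta_mx 0 i) (delta_mx 0 j) = G i j.
Proof. by rewrite /gram_dot -rowE trmx_delta -colE !mxE. Qed.

(** The form at [u - c *: v] is a quadratic in [c] that is nowhere negative. Semidefinite forms may
    vanish at [v], a case handled separately. *)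
Lemma psd_cauchy_schwarz G u v : psd G ->
  gram_dot G u v ^+ 2 <= gram_dot G u u * gram_dot G v v.
Proof.
move=> [sG pG].
have /= := fun c => pG (u - c *: v).
have e c : gram_dot G (u - c *: v) (u - c *: v) =
    gram_dot G u u - 2 * c * gram_dot G u v + c ^+ 2 * gram_dot G v v.
  rewrite -scaleNr !(gram_dotDl, gram_dotDr, gram_dotZl, gram_dotZr).
  by rewrite (gram_dotC v u sG); ring.
move=> H.
have {}H c : 0 <= gram_dot G u u - 2 * c * gram_dot G u v + c ^+ 2 * gram_dot G v v.
  by rewrite -e.
have := pG v; rewrite le_eqVlt => /orP[/eqP v0|v0].
  rewrite -v0 mulr0; have [->|h0] := eqVneq (gram_dot G u v) 0.
    by rewrite expr0n.
  (* When the form vanishes at [v], the quadratic is affine in [c], and this [c] would give it the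
     value -1. *)
  have := H ((gram_dot G u u + 1) / (2 * gram_dot G u v)); rewrite -v0 mulr0 addr0.
  have -> : 2 * ((gram_dot G u u + 1) / (2 * gram_dot G u v)) * gram_dot G u v =
    gram_dot G u u + 1 by field.
  lra.
have := H (gram_dot G u v / gram_dot G v v).
have v1 : gram_dot G v v != 0 by rewrite gt_eqF.
have -> : gram_dot G u u - 2 * (gram_dot G u v / gram_dot G v v) * gram_dot G u v +
    (gram_dot G u v / gram_dot G v v) ^+ 2 * gram_dot G v v =
    (gram_dot G u u * gram_dot G v v - gram_dot G u v ^+ 2) / gram_dot G v v by field.
by rewrite pmulr_lge0 ?invr_gt0// subr_ge0.
Qed.

Lemma psd1 : psd (1%:M : 'M[R]_n).
Proof.
split=> [|u]; first exact: trmx1.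
rewrite /gram_dot mulmx1 mxE; apply: sumr_ge0 => i _.
by rewrite mxE -expr2 sqr_ge0.
Qed.

Lemma tr_mul_rank1 Z (v : 'rV[R]_n) : \tr (Z *m (v^T *m v)) = gram_dot Z v v.
Proof. by rewrite mulmxA mxtrace_mulC /mxtrace big_ord1 mulmxA. Qed.

(* Symmetric elimination: subtracting the rank one matrix of a pivot row keeps
   [G] positive semidefinite, so the induction is on the number of rows left. *)
Lemma psd_mul_tr_ge0 Z G : psd Z -> psd G -> 0 <= \tr (Z^T *m G).
Proof.
move=> [sZ pZ]; rewrite sZ.
(* Only the last [k] rows of [G] may be nonzero; the pivot is the first of them. *)
suff H k : (k <= n)%N -> forall G, psd G ->
    (forall i j : 'I_n, (i < n - k)%N -> G i j = 0) -> 0 <= \tr (Z *m G).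
  by move=> pG; apply: (H n) => // i j; rewrite subnn.
elim: k => [_ {}G _ G0|k IHk kn {}G pG G0].
  rewrite (_ : G = 0) ?mulmx0 ?mxtrace0//; apply/matrixP => i j.
  by rewrite mxE G0// subn0.
have pn : (n - k.+1 < n)%N by rewrite ltn_subrL (leq_trans _ kn).
pose p := Ordinal pn; have [sG qG] := pG.
have symG i j : G i j = G j i by rewrite -[in RHS]sG mxE.
have rowG j : G p j ^+ 2 <= G p p * G j j.
  by rewrite -!gram_dot_delta psd_cauchy_schwarz.
have ltp (i : 'I_n) : (i < n - k)%N -> i = p \/ (i < n - k.+1)%N.
  rewrite -(subnSK kn) ltnS leq_eqVlt => /orP[/eqP ip|]; [|by right].
  by left; apply/val_inj.
(* By Cauchy-Schwarz ([rowG]), a zero pivot makes its whole row vanish, so nothing has to be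
   eliminated. *)
have := qG (delta_mx 0 p); rewrite gram_dot_delta le_eqVlt => /orP[/eqP p0|p0].
  apply: IHk => //; first exact: ltnW.
  move=> i j /ltp[->|]; last exact: G0.
  by apply/eqP; rewrite -sqrf_eq0 eq_le sqr_ge0 andbT (le_trans (rowG _))// -p0 mul0r.
pose v := row p G; pose G' := G - (G p p)^-1 *: (v^T *m v).
have G'E i j : G' i j = G i j - (G p p)^-1 * (G p i * G p j).
  by rewrite !mxE big_ord1 !mxE.
have pE : G p p != 0 by rewrite gt_eqF.
rewrite (_ : G = G' + (G p p)^-1 *: (v^T *m v)); last by rewrite subrK.
rewrite mulmxDr mxtraceD -scalemxAr mxtraceZ tr_mul_rank1.
apply: addr_ge0; last by rewrite mulr_ge0 ?pZ// invr_ge0 ltW.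
apply: IHk; first exact: ltnW.
  split=> [|u].
    by apply/matrixP => i j; rewrite mxE !G'E [G j i]symG [G p j * _]mulrC.
  (* With this formula, nonnegativity of the form of [G'] is Cauchy-Schwarz between [u] and the
     basis vector of the pivot. *)
  have -> : gram_dot G' u u =
      gram_dot G u u - (G p p)^-1 * gram_dot G u (delta_mx 0 p) ^+ 2.
    rewrite {1}/gram_dot mulmxBr mulmxBl mxE -/(gram_dot _ _ _) mxE.
    congr (_ - _); rewrite -scalemxAr -scalemxAl mxE; congr (_ * _).
    rewrite (_ : u *m (v^T *m v) *m u^T = (u *m v^T) *m (v *m u^T)); last by rewrite !mulmxA.
    rewrite mxE big_ord1 expr2.
    have e : (v *m u^T) 0 0 = gram_dot G u (delta_mx 0 p).
      by rewrite gram_dotC// /gram_dot -rowE.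
    by congr (_ * _) => //; rewrite -e -[in RHS](trmxK v) -trmx_mul [in RHS]mxE.
  rewrite subr_ge0 mulrC ler_pdivrMr// -(gram_dot_delta G).
  exact: psd_cauchy_schwarz.
move=> i j /ltp[->|ip]; rewrite G'E; first by field.
by rewrite G0// [G p i]symG (G0 i p ip); ring.
Qed.

End GramDot.

Section Dot.
Context {d : nat}.
Implicit Types u v w : 'rV[R]_d.

Lemma dotv_gram u v : dotv u v = gram_dot 1%:M u v.
Proof. by rewrite /gram_dot mulmx1. Qed.

Lemma dotvDl u v w : dotv (u + v) w = dotv u w + dotv v w.
Proof. by rewrite !dotv_gram gram_dotDl. Qed.

Lemma dotvDr u v w : dotv u (v + w) = dotv u v + dotv u w.
Proof. by rewrite !dotv_gram gram_dotDr. Qed.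

Lemma dotvZl (c : R) u v : dotv (c *: u) v = c * dotv u v.
Proof. by rewrite !dotv_gram gram_dotZl. Qed.

Lemma dotvZr (c : R) u v : dotv u (c *: v) = c * dotv u v.
Proof. by rewrite !dotv_gram gram_dotZr. Qed.

Lemma dotvNl u v : dotv (- u) v = - dotv u v.
Proof. by rewrite -scaleN1r dotvZl mulN1r. Qed.

Lemma dotvNr u v : dotv u (- v) = - dotv u v.
Proof. by rewrite -scaleN1r dotvZr mulN1r. Qed.

Lemma dotvC u v : dotv u v = dotv v u.
Proof. by rewrite !dotv_gram gram_dotC// trmx1. Qed.

Definition dotvE := (dotvDl, dotvDr, dotvNl, dotvNr, dotvZl, dotvZr).

Lemma dotv_suml (I : finType) (F : I -> 'rV[R]_d) v :
  dotv (\sum_i F i) v = \sum_i dotv (F i) v.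
Proof. by rewrite /dotv mulmx_suml summxE. Qed.

Lemma dotv_ge0 u : 0 <= dotv u u.
Proof. by rewrite dotv_gram; have [_] := psd1 (n := d); exact. Qed.

Lemma enorm_ge0 u : 0 <= enorm u.
Proof. exact: sqrtr_ge0. Qed.

Lemma enorm_sqr u : enorm u ^+ 2 = dotv u u.
Proof. by rewrite sqr_sqrtr// dotv_ge0. Qed.

Lemma enormZ (c : R) u : enorm (c *: u) = `|c| * enorm u.
Proof. by rewrite /enorm !dotvE mulrA -expr2 sqrtrM ?sqr_ge0// sqrtr_sqr. Qed.

Lemma dotv_eq0 u : (dotv u u == 0) = (u == 0).
Proof.
apply/eqP/eqP => [|->]; last by rewrite /dotv mul0mx mxE.
rewrite /dotv mxE => /eqP; rewrite psumr_eq0 => [/allP u0|i _]; last first.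
  by rewrite mxE -expr2 sqr_ge0.
apply/rowP => i; have := u0 i (mem_index_enum i).
by rewrite /= mxE -expr2 sqrf_eq0 mxE => /eqP.
Qed.

Lemma dotv_le_enorm u v : dotv u v <= enorm u * enorm v.
Proof.
rewrite (le_trans (ler_norm _))// -ler_sqr ?nnegrE ?mulr_ge0 ?enorm_ge0//.
rewrite exprMn !enorm_sqr real_normK ?num_real// !dotv_gram.
exact/psd_cauchy_schwarz/psd1.
Qed.

End Dot.
End BilinearForms.

(** * First-order inequalities for smooth convex functions *)

Section SmoothConvex.
Context {R : realType} {d : nat}.
Implicit Types (f : 'rV[R]_d -> R^o) (u v x y : 'rV[R]_d).

Lemma derive_gradient f x v : differentiable f x -> 'D_v f x = dotv (gradient f x) v.
Proof.
move=> df; rewrite deriveE// [in LHS](row_sum_delta v) raddf_sum /dotv mxE.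
by apply: eq_bigr => i _; rewrite [LHS]linearZ /= !mxE -deriveE// mulrC.
Qed.

Lemma gradient_affine (c : R) v f : (forall x, f x = c + dotv v x) ->
  forall x, gradient f x = v.
Proof.
move=> fE x; apply/rowP => i; rewrite mxE /derive.
have -> : v 0 i = dotv v (delta_mx 0 i) by rewrite /dotv trmx_delta -colE mxE.
apply: lim_near_cst => //=; near=> h.
have h0 : h != 0 by near: h; exact: nbhs_dnbhs_neq.
rewrite !fE !dotvE [X in _ *: X](_ : _ = h * dotv v (delta_mx 0 i)); last by ring.
by rewrite /GRing.scale/= mulKf.
Unshelve. all: by end_near. Qed.

Lemma is_derive_line f x v (t : R) : differentiable f (x + t *: v) ->
  is_derive t 1 (fun s : R => f (x + s *: v)) (dotv (gradient f (x + t *: v)) v).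
Proof.
move=> df; have := diff_derivable (v := v) df; rewrite -derive_gradient//.
rewrite /derivable /derive => cf.
have e : (fun h : R => h^-1 *: ((fun s : R => f (x + s *: v)) (h *: 1 + t)
                         - f (x + t *: v))) =
    (fun h : R => h^-1 *: (f (h *: v + (x + t *: v)) - f (x + t *: v))).
  apply/funext => h; congr (_ *: (f _ - _)).
  by rewrite [h *: 1]mulr1 scalerDl addrCA.
by split; rewrite /derivable /derive e.
Qed.

(** The directional derivative along [y - x] is a right limit of chord slopes, each at most
    [f y - f x] by convexity. *)
Lemma convex_ge_linearization f x y : differentiable f x -> convex f ->
  f x + dotv (gradient f x) (y - x) <= f y.
Proof.
move=> df cf; rewrite -derive_gradient// -lerBrDl.
have cd := diff_derivable (v := y - x) df.
have cr := cvg_dnbhs_at_right cd.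
rewrite /derive -(cvg_lim _ cr)//; apply: limr_le; first by apply/cvg_ex; eexists; exact: cr.
near=> h.
have h0 : 0 < h by near: h; exact: nbhs_right_gt.
have h1 : h < 1 by near: h; exact: nbhs_right_lt.
have h01 : 0 <= h <= 1 by rewrite !ltW.
have := cf (Itv01 (ltW h0) (ltW h1)) y x.
rewrite !inE => /(_ I I) /=.
rewrite [X in _ <= X](_ : _ = h * f y + (1 - h) * f x)//.
have -> : @conv R (convex_lmodType 'rV[R]_d) (Itv01 (ltW h0) (ltW h1)) y x =
    h *: (y - x) + x.
  rewrite -[LHS]/(h *: y + (1 - h) *: x) scalerBl scale1r scalerBr.
  by rewrite -addrA; congr (_ + _); rewrite addrC.
move=> H; rewrite /GRing.scale /= ler_pdivrMl//.
move: H; lra.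
Unshelve. all: by end_near. Qed.

(** The mean value theorem is applied on [0, 1] to [psi], the gap between [f] and its quadratic
    model along the segment. Cauchy-Schwarz and the Lipschitz bound make its derivative nonpositive
    at positive times. *)
Lemma smooth_descent (L : R) f x v : smooth L f ->
  f (x + v) <= f x + dotv (gradient f x) v + L / 2 * dotv v v.
Proof.
move=> [df lf].
pose psi (t : R) : R := f (x + t *: v) - t * dotv (gradient f x) v - L / 2 * t ^+ 2 * dotv v v.
pose dpsi (t : R) : R := dotv (gradient f (x + t *: v) - gradient f x) v - L * t * dotv v v.
have psi' (t : R) : is_derive t 1 psi (dpsi t).
  have ? := is_derive_line (df (x + t *: v)).
  by apply: is_derive_eq; rewrite /dpsi !dotvE /GRing.scale /=; field.
have [|c] := @MVT R psi dpsi 0 1 ltr01 (fun t _ => psi' t).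
  by apply: derivable_within_continuous => t _; exact: ex_derive.
rewrite in_itv /= => /andP[c0 c1].
have dpsi0 : dpsi c <= 0.
  rewrite /dpsi subr_le0 (le_trans (dotv_le_enorm _ _))//.
  rewrite (le_trans (ler_wpM2r (enorm_ge0 _) (lf _ _)))//.
  rewrite addrAC subrr add0r -enorm_sqr expr2 mulrA ler_wpM2r ?enorm_ge0//.
  by rewrite enormZ gtr0_norm// mulrA.
rewrite subr0 mulr1 /psi scale1r scale0r addr0 => e; move: dpsi0; rewrite -e; lra.
Qed.

(* Both the linearization of [f] at [y] and the descent estimate at [x] are
   evaluated at the gradient step [x - L^-1 *: (gradient f x - gradient f y)]. *)
Lemma smooth_convex_cocoercive (L : R) f x y : 0 < L -> smooth L f -> convex f ->
  0 <= f x - f y - dotv (gradient f y) (x - y)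
       - (2 * L)^-1 * dotv (gradient f x - gradient f y) (gradient f x - gradient f y).
Proof.
move=> L0 sf cf; move hE : (gradient f x - gradient f y) => h.
have := smooth_descent x (- (L^-1 *: h)) sf.
have := convex_ge_linearization (x - L^-1 *: h) (sf.1 y) cf.
rewrite !dotvE => H1 H2.
have Lh : L^-1 * dotv h h = L^-1 * dotv (gradient f x) h - L^-1 * dotv (gradient f y) h.
  by rewrite -{1}hE !dotvE mulrBr.
have e1 : (2 * L)^-1 * dotv h h = L^-1 * dotv h h / 2 by field; rewrite gt_eqF.
have e2 : L / 2 * - (L^-1 * - (L^-1 * dotv h h)) = L^-1 * dotv h h / 2.
  by field; rewrite gt_eqF.
move: H1 H2; rewrite !(mulrN, opprK) e1; lra.
Qed.

(** Otherwise a gradient step of length [L^-1] would decrease [f] strictly, by the descent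
    estimate. *)
Lemma gradient_minimizer (L : R) f x : 0 < L -> smooth L f -> minimizer f x ->
  gradient f x = 0.
Proof.
move=> L0 sf mf; apply/eqP; rewrite -dotv_eq0 eq_le dotv_ge0 andbT.
have := le_trans (mf _) (smooth_descent x (- (L^-1 *: gradient f x)) sf).
rewrite !dotvE; set g := dotv _ _.
have -> : L / 2 * - - (L^-1 * (L^-1 * g)) = L^-1 * g / 2.
  by field; rewrite gt_eqF.
have : 0 < L^-1 by rewrite invr_gt0.
by move=> Li H; rewrite -(pmulr_rle0 _ Li); lra.
Qed.

End SmoothConvex.

(** * Consequences of an optimal dual solution *)

Section DualCertificate.
Context {R : realType}.

Lemma sum_option (T : finType) (F : option T -> R) :
  \sum_i F i = F None + \sum_i F (Some i).
Proof.
rewrite (bigD1 None)//=; congr (_ + _).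
rewrite (reindex_omap Some id) => [|[]//].
by apply: eq_bigl => i; rewrite /= eqxx.
Qed.

(** Applied to right multiplication by [P], this turns the coordinate vectors of the PEP into actual
    iterates. *)
Lemma fixed_step_linear (N : nat) (U V : lmodType R) (W : 'M[R]_N)
    (h : {linear U -> V}) (x0 : U) g n :
  h (fixed_step W x0 g n) = fixed_step W (h x0) (h \o g) n.
Proof.
rewrite /fixed_step; case: unlift => [m|//]; rewrite linearB linear_sum.
by congr (_ - _); apply: eq_bigr => i _; rewrite linearZ.
Qed.

(** This allows the origin to be moved to any fictitious minimizer while the gradients stay
    fixed. *)
Lemma fixed_step_translate (N : nat) (V : lmodType R) (W : 'M[R]_N) (x0 y : V) g n :
  fixed_step W (x0 - y) g n = fixed_step W x0 g n - y.
Proof. by rewrite /fixed_step; case: unlift => [m|//]; rewrite addrAC. Qed.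

Section Gram.
Context {n d : nat}.
Implicit Types P : 'M[R]_(n, d).

Lemma gram_dot_gram P u v : gram_dot (P *m P^T) u v = dotv (u *m P) (v *m P).
Proof. by rewrite /gram_dot /dotv trmx_mul !mulmxA. Qed.

Lemma psd_gram P : psd (P *m P^T).
Proof.
split=> [|u]; first by rewrite trmx_mul trmxK.
by rewrite gram_dot_gram dotv_ge0.
Qed.

End Gram.

Context {N : nat}.
Variables (L D : R) (W : 'M[R]_N).

(** Since g_star = 0, this is the quantity that condition (ii) makes positive at some primal
    optimum. *)
Lemma pepQ_star f (G : 'M[R]_N.+2) i :
  pepQ L W f G (Some i) None =
  f (Some i) - f None - (2 * L)^-1 * G (lift ord0 i) (lift ord0 i).
Proof. by rewrite /pepQ /= !subr0 gram_dot_delta /gram_dot !mul0mx mxE subr0. Qed.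

Lemma pepQ0 f i j : pepQ L W f (0 : 'M[R]_N.+2) i j = f i - f j.
Proof. by rewrite /pepQ /gram_dot !(mulmx0, mul0mx) mxE mulr0 !subr0. Qed.

Lemma pep_optimal_value f G : pep_optimal L D W f G -> pep_value L D W = (pep_obj f)%:E.
Proof.
move=> [fea opt]; apply/eqP; rewrite eq_le; apply/andP; split.
  by apply: ge_ereal_sup => _ [[f' G'] /= H <-]; rewrite lee_fin (opt _ G').
by apply: ereal_sup_ubound; exists (f, G).
Qed.

Lemma dual_optimal_value r lam sigma Z :
  dual_optimal L D W r lam sigma Z -> dual_value L D W = r%:E.
Proof.
move=> [fea opt]; apply/eqP; rewrite eq_le; apply/andP; split.
  by apply: ereal_inf_lbound; exists r => //; exists lam, sigma, Z.
by apply: le_ereal_inf_tmp => _ [r' [l' [s' [Z' H]]] <-]; rewrite lee_fin; exact: opt H.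
Qed.

(** With no duality gap, the dual identity writes 0 as a sum of nonnegative terms, so each of them
    vanishes. *)
Lemma complementary_slackness r lam sigma Z f G i j :
  dual_feasible L D W r lam sigma Z -> pep_feasible L D W f G -> pep_obj f = r ->
  lam i j * pepQ L W f G i j = 0.
Proof.
move=> [lam0 sigma0 pZ dual] [Q0 D0 pG] fr.
have lQ k l : 0 <= lam k l * pepQ L W f G k l by rewrite mulr_ge0.
have := dual f G pG.1; rewrite fr subrr (bigD1 i)//= (bigD1 j)//=.
have := psd_mul_tr_ge0 pZ pG; have := mulr_ge0 sigma0 D0; have := lQ i j.
have : 0 <= \sum_(k | k != i) \sum_l lam k l * pepQ L W f G k l.
  by apply: sumr_ge0 => k _; apply: sumr_ge0.
have : 0 <= \sum_(l | l != j) lam i l * pepQ L W f G i l by apply: sumr_ge0.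
lra.
Qed.

(** Complementary slackness at the primal optimum given by condition (ii) for [i] kills
    [lam (Some i) None]. The optimum for i = N has f_N - f_star > |g_N|^2 / (2L) >= 0, so the common
    optimal value is positive. *)
Lemma nondegenerate_dual : 0 < L -> nondegenerate_method L D W ->
  exists lam sigma Z, [/\ dual_feasible L D W (PEP L D W) lam sigma Z,
    0 < PEP L D W & forall i, lam (Some i) None = 0].
Proof.
move=> L0 [strong _ [r [lam [sigma [Z opt]]]] nd].
have pv : pep_value L D W = r%:E by rewrite strong (dual_optimal_value opt).
have objE f G : pep_optimal L D W f G -> pep_obj f = r.
  by move=> /pep_optimal_value; rewrite pv => -[].
rewrite /PEP pv /=; exists lam, sigma, Z; split; first exact: opt.1.
  have [f [G [fGo fN]]] := nd ord_max; rewrite -(objE _ _ fGo) /pep_obj.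
  have [_ _ [_ /(_ (delta_mx 0 (lift ord0 ord_max)))]] := fGo.1.
  rewrite gram_dot_delta => G0; rewrite subr_gt0 (lt_le_trans fN)// gerBl.
  by rewrite mulr_ge0// invr_ge0 mulr_ge0// ltW.
move=> i; have [f [G [fGo fi]]] := nd i.
have := complementary_slackness (Some i) None opt.1 fGo.1 (objE _ _ fGo).
move=> /eqP; rewrite mulf_eq0 pepQ_star => /orP[/eqP//|/eqP]; move: fi; lra.
Qed.

Section Certificate.
Variables (r sigma : R) (lam : option 'I_N.+1 -> option 'I_N.+1 -> R) (Z : 'M[R]_N.+2).
Hypothesis dual : dual_feasible L D W r lam sigma Z.
Hypothesis lam_star : forall i, lam (Some i) None = 0.

Lemma dual_sigma : r = sigma * D ^+ 2.
Proof.
have [_ _ _ /(_ (fun=> 0) 0 (trmx0 _ _ _))] := dual.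
rewrite /pep_obj !subr0 /pepD mxE subr0 mulmx0 mxtrace0 addr0 => ->.
by rewrite big1 ?add0r// => i _; rewrite big1// => j _; rewrite pepQ0 subrr mulr0.
Qed.

Lemma dual_sum : \sum_i lam None (Some i) = 1.
Proof.
(* Evaluating at the indicator of star with zero Gram matrix reads off the coefficient of f_star. *)
have [_ _ _ /(_ (fun i => (i == None)%:R) 0 (trmx0 _ _ _))] := dual.
rewrite /pep_obj /pepD mxE subr0 mulmx0 mxtrace0 addr0 -dual_sigma /= sub0r opprK.
rewrite addrC => /addIr e; rewrite -[RHS]/(true%:R) e sum_option [X in _ = _ + X]big1 ?addr0.
  rewrite sum_option pepQ0 subrr mulr0 add0r.
  by apply: eq_bigr => i _; rewrite pepQ0 /= subr0 mulr1.
move=> i _; rewrite sum_option lam_star mul0r add0r big1// => j _.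
by rewrite pepQ0 /= subrr mulr0.
Qed.

(* The minimizer is placed at the origin, and [y] (the initial displacement) is
   unrelated to the data [F], [g]: the dual identity holds for all of them. *)
Lemma dual_certificate (d : nat) (F : 'I_N.+1 -> R) (g : 'I_N.+1 -> 'rV[R]_d) y :
  let x := fixed_step W y g in
  (forall i j, 0 <= F i - F j - dotv (g j) (x i - x j)
                    - (2 * L)^-1 * dotv (g i - g j) (g i - g j)) ->
  F ord_max <= \sum_i lam None (Some i) *
                  (F i - dotv (g i) (x i) + (2 * L)^-1 * dotv (g i) (g i))
               + sigma * dotv y y.
Proof.
move=> x Q0; have [lam0 sigma0 pZ dualE] := dual.
(* Vectors are rows here, so [P] is the transpose of [y, g_0, ..., g_N] and the Gram matrix is
   [P *m P^T]. *)
pose P : 'M[R]_(N.+2, d) := \matrix_i (if unlift ord0 i is Some k then g k else y).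
have P0 : delta_mx 0 ord0 *m P = y by rewrite -rowE rowK unlift_none.
have PS k : delta_mx 0 (lift ord0 k) *m P = g k by rewrite -rowE rowK liftK.
have gP k : gcoord (Some k) *m P = g k := PS k.
have xP k : xcoord W (Some k) *m P = x k.
  rewrite -[LHS]/(mulmxr P _) fixed_step_linear /= P0 /x.
  by rewrite /fixed_step; case: unlift => // m; under eq_bigr do rewrite /= PS.
(* The value at star is set to 0. The resulting Q_{i,star} may be negative, but their multipliers
   are zero. *)
pose f i : R := oapp F 0 i; pose G := P *m P^T.
have Qss : pepQ L W f G None None = 0.
  by rewrite /pepQ !subrr /gram_dot !mul0mx mxE mulr0 !subr0.
have Qsi i : pepQ L W f G None (Some i) =
    - (F i - dotv (g i) (x i) + (2 * L)^-1 * dotv (g i) (g i)).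
  by rewrite /pepQ !gram_dot_gram !mulmxBl gP xP !mul0mx !sub0r !dotvE /=; ring.
have Qij i j : 0 <= pepQ L W f G (Some i) (Some j).
  by rewrite /pepQ !gram_dot_gram !mulmxBl !gP !xP; exact: Q0.
have Dy : pepD D G = D ^+ 2 - dotv y y.
  by rewrite /pepD -gram_dot_delta gram_dot_gram P0.
have := dualE f G (psd_gram P).1.
(* The dual identity also holds at infeasible points, so [y] may be longer than [D]; the constants r
   and sigma D^2 cancel. *)
rewrite Dy /pep_obj /f /= subr0 !sum_option Qss mulr0 add0r mulrBr -dual_sigma.
rewrite (eq_bigr _ (fun i _ => congr1 (fun q => lam None (Some i) * q) (Qsi i))).
under eq_bigr do rewrite mulrN.
rewrite sumrN.
have := psd_mul_tr_ge0 pZ (psd_gram P).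
have : 0 <= \sum_i \sum_j lam (Some i) j * pepQ L W f G (Some i) j.
  apply: sumr_ge0 => i _; rewrite sum_option lam_star mul0r add0r.
  by apply: sumr_ge0 => j _; rewrite mulr_ge0.
rewrite -/f -/G; lra.
Qed.

End Certificate.
End DualCertificate.

(** * From the dual certificate to the two chains of inequalities *)

Theorem theorem6p1 (R : realType) (N : nat) (L D : R) (W : 'M[R]_N)
    (hN : (1 <= N)%N) (hL : 0 < L) (hD : 0 < D)
    (hW : is_trig_mx W) (hnd : nondegenerate_method L D W) :
  exists a : 'rV[R]_N.+1,
    [/\ forall i, 0 <= a 0 i,
        \sum_i a 0 i = 1 &
        forall (d : nat) (f : 'rV[R]_d -> R^o) (xstar x0 : 'rV[R]_d)
               (x : 'I_N.+1 -> 'rV[R]_d),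
          (1 <= d)%N ->
          smooth L f -> convex f -> minimizer f xstar ->
          enorm (x0 - xstar) <= D ->
          (forall n, x n = fixed_step W x0 (fun i => gradient f (x i)) n) ->
          let g i := gradient f (x i) in
          let fN := f (x ord_max) in
          let fstar := f xstar in
          let alpha : 'rV[R]_d -> R^o := fun y =>
            \sum_i a 0 i * (f (x i) + dotv (g i) (y - x i)
                            + (2 * L)^-1 * enorm (g i) ^+ 2) in
          let z := x0 - (D ^+ 2 / (2 * PEP L D W)) *: affine_gradient alpha in
          [/\ affine_below_at f xstar alpha,
              fN - fstar
                <= fN - alpha xstar
                   + PEP L D W / D ^+ 2 * enorm (z - xstar) ^+ 2
                <= PEP L D W &
              fN - fstar
                <= fN - (alpha x0 - D * enorm (affine_gradient alpha))
                <= PEP L D W]].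
Proof.
have [lam [sigma [Z [dual p0 lam_star]]]] := nondegenerate_dual hL hnd.
set p := PEP L D W in dual p0 *.
have sigmaE : sigma = p / D ^+ 2.
  by rewrite (dual_sigma dual) mulfK// expf_neq0// gt_eqF.
have [lam0 _ _ _] := dual.
exists (\row_i lam None (Some i)); split=> [i||].
- by rewrite mxE.
- by under eq_bigr do rewrite mxE; exact: dual_sum dual lam_star.
move=> d f xs x0 x _ sf cf mf x0D xE g fN fstar alpha z.
have a1 : \sum_i lam None (Some i) = 1 by exact: dual_sum dual lam_star.
have alphaE y : alpha y = \sum_i lam None (Some i) *
    (f (x i) + dotv (g i) (y - x i) + (2 * L)^-1 * dotv (g i) (g i)).
  by apply: eq_bigr => i _; rewrite mxE enorm_sqr.
pose v := \sum_i lam None (Some i) *: g i.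
have alpha_affine y y' : alpha y = alpha y' + dotv v (y - y').
  rewrite !alphaE dotv_suml -big_split /=; apply: eq_bigr => i _.
  by rewrite !dotvE; ring.
have gradE : affine_gradient alpha = v.
  apply: (@gradient_affine _ _ (alpha 0)) => y.
  by rewrite [LHS](alpha_affine y 0) subr0.
have cert y : fN <= alpha (x0 - y) + sigma * dotv y y.
  have stepE i : fixed_step W y g i = x i - (x0 - y).
    by rewrite [x i]xE -fixed_step_translate subKr.
  have -> : alpha (x0 - y) = \sum_i lam None (Some i) *
      (f (x i) - dotv (g i) (fixed_step W y g i) + (2 * L)^-1 * dotv (g i) (g i)).
    by rewrite alphaE; apply: eq_bigr => i _; rewrite stepE -dotvNr opprB.
  apply: (dual_certificate dual lam_star) => i j.
  by rewrite !stepE (opprD (x j)) addrACA subrr addr0; exact: smooth_convex_cocoercive.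
(* Cocoercivity between [xs], where the gradient is zero, and [x i] bounds each summand of
   [alpha xs] by [fstar]; the weights sum to 1. *)
have below : alpha xs <= fstar.
  rewrite -subr_ge0 -[fstar]mul1r -a1 mulr_suml alphaE -sumrB.
  apply: sumr_ge0 => i _; rewrite -mulrBr mulr_ge0//.
  have := smooth_convex_cocoercive xs (x i) hL sf cf.
  rewrite (gradient_minimizer hL sf mf) !sub0r !dotvE opprK /fstar /g; lra.
(* [s] is the step length in [z] and equals 1 / (2 sigma). *)
move wE : (x0 - xs) x0D => w x0D; pose s := D ^+ 2 / (2 * p).
have s0 : 0 < s by rewrite divr_gt0 ?mulr_gt0 ?exprn_gt0.
have sigmas : sigma * s = 1 / 2 by rewrite sigmaE /s; field; rewrite !gt_eqF.
have sigma0 : 0 <= sigma by rewrite sigmaE divr_ge0// ltW// exprn_gt0.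
have fN_le : fN <= alpha x0 - s / 2 * dotv v v.
  (* This choice of [y] minimizes the right-hand side of [cert], a quadratic in [y]. *)
  have := cert (s *: v); rewrite (alpha_affine _ x0) (addrAC x0) subrr sub0r !dotvE.
  have -> : sigma * (s * (s * dotv v v)) = sigma * s * s * dotv v v by ring.
  rewrite sigmas; lra.
have ww : dotv w w <= D ^+ 2.
  by rewrite -enorm_sqr ler_sqr ?nnegrE ?enorm_ge0// ltW.
have alpha_xs : alpha xs = alpha x0 - dotv v w.
  by rewrite (alpha_affine xs x0) -wE -dotvNr opprB.
have vw : dotv v w <= D * enorm v.
  by rewrite (le_trans (dotv_le_enorm _ _))// mulrC ler_wpM2r ?enorm_ge0.
have zE : enorm (z - xs) ^+ 2 = dotv w w - 2 * s * dotv v w + s ^+ 2 * dotv v v.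
  by rewrite enorm_sqr /z gradE -/s addrAC wE !dotvE (dotvC w v); ring.
have dist : p / D ^+ 2 * enorm (z - xs) ^+ 2 =
    sigma * dotv w w - dotv v w + s / 2 * dotv v v.
  rewrite zE -sigmaE mulrDr mulrBr.
  have -> : sigma * (2 * s * dotv v w) = 2 * (sigma * s) * dotv v w by ring.
  have -> : sigma * (s ^+ 2 * dotv v v) = sigma * s * s * dotv v v by ring.
  by rewrite sigmas; field.
have sw : sigma * dotv w w <= p.
  by rewrite [leRHS](dual_sigma dual) ler_wpM2l.
split.
- split; last exact: below.
  exists (alpha 0), v => y.
  by rewrite (alpha_affine y 0) subr0.
(* The terms in [dotv v w] cancel; [fN_le] then leaves sigma |w|^2, at most [p] by [sw]. *)
- apply/andP; split; last by rewrite dist alpha_xs; lra.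
  have : 0 <= p / D ^+ 2 * enorm (z - xs) ^+ 2.
    by rewrite -sigmaE mulr_ge0// sqr_ge0.
  lra.
- rewrite gradE; apply/andP; split; first by move: below; rewrite alpha_xs; lra.
  (* As D^2 / (2s) = p, this square gives D |v| <= (s / 2) |v|^2 + p, which combines with
     [fN_le]. *)
  have : 0 <= s / 2 * (enorm v - D / s) ^+ 2 by rewrite mulr_ge0 ?sqr_ge0// divr_ge0// ltW.
  have -> : s / 2 * (enorm v - D / s) ^+ 2 = s / 2 * dotv v v - D * enorm v + p.
    by rewrite -enorm_sqr /s; field; rewrite !gt_eqF.
  lra.
Qed.
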